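(* Let $s\ge 1$ be an integer. For any family $F=\{(x-a_i)^{e_i} : 1\le i\le s\}$ with $a_i\in\mathbb{R}$, $e_i\in\mathbb{N}$, $e_i\ge\max(1,2s-4)$ for all $i$, and the pairs $(a_i,e_i)$ pairwise distinct, the elements of $F$ are linearly independent.
   Context: Linear independence is over $\mathbb{R}$ in the space $\mathbb{R}[x]$. *)

(* Defs.v *)
From HB Require Import structures.
From mathcomp Require Import all_boot all_order all_algebra.
From mathcomp Require Import reals.

Set Implicit Arguments.
Unset Strict Implicit.
Unset Printing Implicit Defensive.

Import GRing.Theory.
Local Open Scope ring_scope.

(* [free] from vector.v needs a finite-dimensional vectType, which {poly K} is
   not; this is the same notion for a finite family in an arbitrary module. *)
Definition lin_indep (K : pzRingType) (V : lmodType K) (I : finType)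
    (v : I -> V) : Prop :=
  forall c : I -> K, \sum_i c i *: v i = 0 -> forall i, c i = 0.

(* Main.v *)
Require Import Defs.
From mathcomp Require Import all_boot all_order all_algebra.
From mathcomp Require Import reals.
From mathcomp Require Import polyrcf lra zify.

Set Implicit Arguments.
Unset Strict Implicit.
Unset Printing Implicit Defensive.

Import Order.TTheory GRing.Theory Num.Theory.
Local Open Scope ring_scope.

(** Suppose that [\sum_i c i *: ('X - a i) ^+ e i = 0] with all [c i != 0], and
    consider the spline obtained by truncating each term, that is, by letting
    it count only to the right of its knot [a i]. The spline vanishes to the
    left of all knots, and also to the right of all of them because of the
    relation. So Rolle's theorem applies with two additional zeros, one at each
    end: if a function of this kind takes [N] nonzero values of alternating
    signs, then it has [N + 1] increments of alternating signs, and its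
    derivative takes [N + 1] alternating values.

    The only obstruction is that the [k]-th derivative jumps at the knots of
    the terms with [e i = k], so that the increment over an interval containing
    such a knot says nothing about the derivative there. Each jump spoils one
    interval, and removing one item from an alternating sequence costs at most
    two alternating items ([rolle_spline]). Hence the number [N_k] of
    alternating values of the [k]-th derivative satisfies
    [k + 1 <= N_k + 2 * #{i | e i < k}] ([spline_alternates]).

    Let [d] be the largest exponent, [t] the number of terms of exponent [d]
    and [n] the number of all terms. The [d]-th derivative is a step function
    with [t] steps that vanishes at both ends, so [N_d + 1 <= t]. Altogether
    [2 <= t] and [d + t + 2 <= 2 * n] ([relation_degree_bound]).

    If moreover all exponents are at least [2 * n - 4], then [t = 2] and
    [d = 2 * n - 4]; so all exponents are equal to [d], whence [n = t = 2] and
    [d = 0], against [1 <= e i]. *)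

(** * Derivatives of shifted powers *)

Lemma derivn_XsubC_exp (R : comNzRingType) (a : R) (m k : nat) :
  (('X - a%:P) ^+ m)^`(k) = ('X - a%:P) ^+ (m - k) *+ m ^_ k.
Proof.
elim: k => [|k IHk]; first by rewrite derivn0 subn0 ffactn0.
rewrite derivnS IHk derivMn deriv_exp derivXsubC mul1r -mulrnA ffactnSr mulnC.
by rewrite subnS.
Qed.

Lemma horner_derivn_XsubC_exp (R : comNzRingType) (a : R) (m k : nat) :
  m != k -> (('X - a%:P) ^+ m)^`(k).[a] = 0.
Proof.
move=> neq_mk; rewrite derivn_XsubC_exp hornerMn horner_exp hornerXsubC subrr.
case: (ltngtP m k) neq_mk => // [lt_mk|lt_km] _.
  by rewrite ffact_small // mulr0n.
by rewrite expr0n subn_eq0 leqNgt lt_km mul0rn.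
Qed.

(** * Alternating values and alternating increments *)

(** The points [xs] increase strictly from [y] and [f] has alternating signs on
    them, starting with [(-1) ^+ b]. *)
Fixpoint alternates (R : numDomainType) (f : R -> R) (b : bool) (y : R)
    (xs : seq R) : bool :=
  if xs is x :: xs' then
    [&& y < x, 0 < (-1) ^+ b * f x & alternates f (~~ b) x xs']
  else true.

Fixpoint alternating_increments (R : numDomainType) (f : R -> R) (b : bool)
    (y : R) (xs : seq R) : bool :=
  if xs is x :: xs' then
    [&& y < x, 0 < (-1) ^+ b * (f x - f y)
      & alternating_increments f (~~ b) x xs']
  else true.

Lemma alternatesW (R : numDomainType) (f : R -> R) b y y' xs :
  y' <= y -> alternates f b y xs -> alternates f b y' xs.
Proof.
by case: xs => //= x xs le_y /and3P[/(le_lt_trans le_y)-> -> ->].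
Qed.

(** The zeros of [f] at [lo] and far to the right each contribute one more
    increment, so there is one increment more than there are values. *)
Lemma alternates_increments (R : realDomainType) (f : R -> R) b lo x xs :
  f lo = 0 -> (exists z0, forall z, z0 <= z -> f z = 0) ->
  alternates f b lo (x :: xs) ->
  exists hi, alternating_increments f b lo (rcons (x :: xs) hi).
Proof.
move=> flo [z0 fz0] /= /and3P[lt_lo fx alt].
suff [hi inc] : exists hi, alternating_increments f (~~ b) x (rcons xs hi).
  by exists hi; rewrite lt_lo flo subr0 fx.
elim: xs b x lt_lo fx alt => [|x' xs IHxs] b x lt_lo fx /=.
  exists (Num.max z0 (x + 1)); rewrite fz0 ?le_max ?lexx // lt_max.
  rewrite ltrDl ltr01 orbT sub0r.
  by rewrite signrN mulrNN fx.
case/and3P=> lt_xx' fx' alt.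
have [hi inc] := IHxs _ _ (lt_trans lt_lo lt_xx') fx' alt.
exists hi; rewrite lt_xx' inc andbT /= mulrBr addr_gt0 //.
by rewrite signrN mulNr opprK.
Qed.

(** * Truncated sums of shifted powers *)

Section Spline.

Variables (R : rcfType) (I : finType) (a : I -> R) (e : I -> nat) (c : I -> R).

(** The polynomial that coincides near the right of [x] with the [k]-th
    derivative of the truncated sum. Truncation comes before derivation, so
    that all derivatives are taken inside [{poly R}] and a term simply
    disappears when [k] exceeds its exponent. *)
Definition piece (k : nat) (x : R) : {poly R} :=
  (\sum_(i | a i <= x) c i *: ('X - (a i)%:P) ^+ e i)^`(k).

Definition spline (k : nat) (x : R) : R := (piece k x).[x].

Lemma pieceE k x :
  piece k x = \sum_(i | a i <= x) c i *: (('X - (a i)%:P) ^+ e i)^`(k).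
Proof. by rewrite /piece linear_sum; apply: eq_bigr => i _; rewrite /= derivnZ. Qed.

Lemma eq_piece k x y :
  (forall i, (a i <= x) = (a i <= y)) -> piece k x = piece k y.
Proof. by move=> eq_xy; rewrite /piece (eq_bigl _ _ eq_xy). Qed.

Definition jump k u v : pred I :=
  [pred i | [&& c i != 0, e i == k & u < a i <= v]].

Definition num_jumps k u := #|[pred i | [&& c i != 0, e i == k & u < a i]]|.

(** A knot at the right end [v] does no harm unless it is a jump: a term of
    exponent different from [k] has a [k]-th derivative that vanishes at its
    own knot. *)
Lemma spline_poly k u v : u <= v ->
  jump k u v =1 pred0 -> (forall i, ~~ (u < a i < v)) ->
  spline k v = (piece k u).[v].
Proof.
move=> le_uv nojump noknot; rewrite /spline !pieceE !horner_sum.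
rewrite (bigID (fun i => a i <= u)) /= [X in _ + X]big1 ?addr0.
  by apply: eq_bigl => i; case: (leP (a i) u) => [/le_trans->|_]; rewrite ?andbF.
move=> i /andP[le_v]; rewrite -ltNge => lt_u.
have := noknot i; rewrite lt_u /= -leNgt => ge_v.
have /eqP<- : a i == v by rewrite eq_le le_v.
rewrite hornerZ; have := nojump i; rewrite /jump /= lt_u le_v andbT.
have [->|_] /= := eqVneq (c i) 0; first by rewrite mul0r.
by rewrite andbT => /negbT/horner_derivn_XsubC_exp->; rewrite mulr0.
Qed.

(** A sign-only mean value theorem. The usual one would fail, since the
    derivative of the spline may jump at knots inside the interval; but an
    increment of a given sign over [u, v] leaves an increment of that sign over
    one of the two parts cut by a knot, and on an interval without interior
    knots the spline is a polynomial. *)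
Lemma spline_mvt_sign (s : R) k u v : u < v -> jump k u v =1 pred0 ->
  0 < s * (spline k v - spline k u) ->
  exists2 z, u < z < v & 0 < s * spline k.+1 z.
Proof.
have [n] := ubnP #|[pred i | u < a i < v]|.
elim: n u v => // n IHn u v lt_n lt_uv nojump inc.
have [i /= /andP[lt_ui lt_iv]|noknot] := pickP [pred i | u < a i < v]; last first.
  have noknot' i : ~~ (u < a i < v) by rewrite [_ && _]noknot.
  have Ev := spline_poly (ltW lt_uv) nojump noknot'.
  have [z] := poly_mvt (piece k u) lt_uv.
  rewrite -Ev -/(spline k u) in_itv /= => /andP[lt_uz lt_zv] Einc.
  exists z; first by rewrite lt_uz.
  rewrite /spline -(@eq_piece k.+1 u z) => [|i].
    by move: inc; rewrite Einc mulrA pmulr_lgt0 // subr_gt0.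
  apply/idP/idP=> [/le_trans->//|le_iz]; first exact: ltW.
  have := noknot' i; rewrite (le_lt_trans le_iz lt_zv) andbT -leNgt. exact.
have knots_sub u' v' : u <= u' -> v' <= v -> (u' == a i) || (v' == a i) ->
    (#|[pred j | (u' < a j < v')%R]| < n)%N.
  move=> le_u le_v eq_i; rewrite -ltnS; apply: leq_trans lt_n.
  apply/proper_card/properP; split.
    apply/subsetP=> j; rewrite !inE => /andP[lt_u lt_v].
    by rewrite (le_lt_trans le_u lt_u) (lt_le_trans lt_v le_v).
  exists i; rewrite !inE ?lt_ui //.
  by case/orP: eq_i => /eqP->; rewrite ltxx ?andbF.
have nojump_sub u' v' : u <= u' -> v' <= v -> jump k u' v' =1 pred0.
  move=> le_u le_v j; have := nojump j; rewrite /jump /=.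
  apply: contraFF => /and4P[-> -> lt_u lt_v].
  by rewrite (le_lt_trans le_u lt_u) (le_trans lt_v le_v).
have: 0 < s * (spline k v - spline k (a i)) \/
      0 < s * (spline k (a i) - spline k u).
  apply/orP; apply: contraLR inc; rewrite negb_or -!leNgt => /andP[le1 le2].
  by lra.
case=> [inc1|inc2].
  have [||//|z /andP[lt_z lt_zv] ?] := IHn (a i) v _ lt_iv.
  - by apply: knots_sub; rewrite ?eqxx // ltW.
  - by apply: nojump_sub; rewrite // ltW.
  by exists z; rewrite // (lt_trans lt_ui).
have [||//|z /andP[lt_z lt_zv] ?] := IHn u (a i) _ lt_ui.
- by apply: knots_sub; rewrite ?eqxx ?orbT // ltW.
- by apply: nojump_sub; rewrite // ltW.
by exists z; rewrite // lt_z (lt_trans lt_zv).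
Qed.

Lemma num_jumps_mono k u v : u <= v -> (num_jumps k v <= num_jumps k u)%N.
Proof.
move=> le_uv; apply/subset_leq_card/subsetP=> i; rewrite !inE.
by case/and3P=> -> ->; apply: le_lt_trans.
Qed.

Lemma num_jumps_lt k u v i : u <= v -> jump k u v i ->
  (num_jumps k v < num_jumps k u)%N.
Proof.
move=> le_uv /and4P[ci ei lt_u le_v]; apply/proper_card/properP; split.
  by apply/subsetP=> j; rewrite !inE => /and3P[-> ->]; apply: le_lt_trans.
by exists i; rewrite !inE ci ei // -leNgt.
Qed.

(** Going through the intervals from right to left, an interval without jump
    yields a value of the derivative with the sign of the increment. It is
    added to the list if that keeps the signs alternating, and is discarded
    otherwise. The term [b' != b] records that the list found so far does not
    start with the sign of the first increment: this makes the invariant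
    inductive, with a loss of at most two values per jump. *)
Lemma rolle_spline k b y ys : alternating_increments (spline k) b y ys ->
  exists b' zs, alternates (spline k.+1) b' y zs /\
    (size ys + (b' != b) <= size zs + 2 * num_jumps k y)%N.
Proof.
elim: ys b y => [|y1 ys IHys] b y /=.
  by exists b, [::]; rewrite eqxx.
case/and3P=> lt_y inc /IHys[b' [zs [alt size_zs]]].
have altW := alternatesW (ltW lt_y) alt.
have le_J := num_jumps_mono k (ltW lt_y).
have [i jump_i|nojump] := pickP (jump k y y1).
  have := num_jumps_lt (ltW lt_y) jump_i.
  by exists b', zs; split=> //; move: size_zs; case: b b' {inc alt altW} => [] [] /=; lia.
have [eq_b|neq_b] := eqVneq b' b.
  exists b', zs; split=> //; move: size_zs; rewrite eq_b eqxx.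
  by case: b {inc eq_b} => /=; lia.
have eq_b : b' = ~~ b by case: b b' neq_b {inc alt altW size_zs} => [] [].
have [z /andP[lt_yz lt_zy1] fz] := spline_mvt_sign lt_y nojump inc.
exists b, (z :: zs); rewrite /= lt_yz fz -eq_b (alternatesW (ltW lt_zy1)) //.
by split=> //; move: size_zs; rewrite eq_b !eqxx /=; lia.
Qed.

(** If the derivative vanishes then no interval is free of jumps, so that the
    loss is only one per jump. *)
Lemma rolle_step_spline k b y ys :
  (forall x, spline k.+1 x = 0) -> alternating_increments (spline k) b y ys ->
  (size ys <= num_jumps k y)%N.
Proof.
move=> f'0; elim: ys b y => [|y1 ys IHys] b y //= /and3P[lt_y inc /IHys le_ys].
have [i jump_i|nojump] := pickP (jump k y y1).
  exact: leq_ltn_trans (num_jumps_lt (ltW lt_y) jump_i).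
have [z _] := spline_mvt_sign lt_y nojump inc.
by rewrite f'0 mulr0 ltxx.
Qed.


(** If the derivative is nonzero at [x], then the polynomial piece starting at
    [x] is nonzero, hence has a non-root before the next knot. *)
Lemma spline_neq0_antideriv k x :
  spline k.+1 x != 0 -> exists y, spline k y != 0.
Proof.
rewrite /spline /piece derivnS -/(piece k x) => f'x.
have p_neq0 : piece k x != 0.
  by apply: contraNneq f'x => ->; rewrite deriv0 horner0.
(* [x'] is the next knot to the right of [x], or [x + 1] if that is closer. *)
pose x' := \big[Num.min/x + 1]_(i | x < a i) a i.
have lt_xx' : x < x' by apply/bigmin_gtP; rewrite ltrDl ltr01.
have [y y_in] := neighpr_wit lt_xx' p_neq0.
have lt_xy : x < y by rewrite (itvP y_in).
have lt_yx' : y < x'.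
  have := next_root_in (piece k x) x x'.
  move: y_in; rewrite !in_itv /= => /andP[_ lt_y] /andP[_].
  by rewrite (max_l (ltW lt_xx')); apply: lt_le_trans.
exists y; rewrite -/(piece k y); suff <- : piece k x = piece k y by apply: neighpr_root y_in.
apply: eq_piece => i.
apply/idP/idP => [/le_trans->//|le_y]; first exact: ltW.
rewrite leNgt; apply/negP => lt_x.
have := lt_le_trans lt_yx' (bigmin_le_cond (x + 1) a lt_x).
by rewrite ltNge le_y.
Qed.

Lemma spline_eq0_right : \sum_i c i *: ('X - (a i)%:P) ^+ e i = 0 ->
  exists z0, forall k z, z0 <= z -> spline k z = 0.
Proof.
move=> rel; exists (\big[Num.max/0]_i a i) => k z le_z.
have le_a i : a i <= z by apply: le_trans le_z; apply: le_bigmax.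
rewrite /spline /piece (eq_bigl xpredT) ?rel => [|i]; last by rewrite le_a.
by rewrite linear0 horner0.
Qed.

Lemma spline_eq0_left k lo x :
  (forall i, lo < a i) -> x <= lo -> spline k x = 0.
Proof.
move=> lo_lt le_x; rewrite /spline /piece big_pred0 ?linear0 ?horner0 // => i.
by apply/negbTE; rewrite -ltNge (le_lt_trans le_x).
Qed.

Definition num_terms := #|[pred i | c i != 0]|.

Definition num_below k := #|[pred i | (c i != 0) && (e i < k)%N]|.

Definition num_equal k := #|[pred i | (c i != 0) && (e i == k)]|.

Lemma num_belowS k : num_below k.+1 = (num_below k + num_equal k)%N.
Proof.
rewrite /num_below -(cardID [pred i | (e i < k)%N]); congr (_ + _)%N.
  by apply: eq_card => i; rewrite !inE; case: (c i == 0) => //=; lia.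
by apply: eq_card => i; rewrite !inE; case: (c i == 0) => //=; lia.
Qed.

Lemma num_jumps_left k lo : (forall i, lo < a i) -> num_jumps k lo = num_equal k.
Proof.
by move=> lo_lt; apply: eq_card => i; rewrite !inE lo_lt andbT.
Qed.

(** The number of alternating values grows by at least one with each
    derivative, from one at order [0], except for a loss of at most two per
    jump met on the way. Rolle's lemma alone may return no value at all once
    there are many jumps; then a single nonzero value does at least as well,
    which is why no derivative up to order [k] may vanish identically. *)
Lemma spline_alternates lo : \sum_i c i *: ('X - (a i)%:P) ^+ e i = 0 ->
  (forall i, lo < a i) ->
  forall k, (forall j, (j <= k)%N -> exists x, spline j x != 0) ->
  exists b x xs, alternates (spline k) b lo (x :: xs) /\
    (k < (size xs).+1 + 2 * num_below k)%N.
Proof.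
move=> /spline_eq0_right[z0 f_right] lo_lt.
have one_value k x : spline k x != 0 ->
    alternates (spline k) (spline k x < 0) lo [:: x].
  move=> fx; rewrite /= -normrEsign normr_gt0 fx !andbT ltNge.
  by apply: contra fx => /(spline_eq0_left _ lo_lt)->.
elim=> [|k IHk] f_neq0; have [x /one_value alt_x] := f_neq0 _ (leqnn _).
  by exists (spline 0 x < 0), x, [::].
have [j le_jk|b [y [ys [alt size_ys]]]] := IHk; first by apply: f_neq0; lia.
have f_lo := spline_eq0_left k lo_lt (lexx lo).
have [hi inc] := alternates_increments f_lo (ex_intro _ z0 (f_right k)) alt.
have [b' [zs [alt']]] := rolle_spline inc.
rewrite num_jumps_left // size_rcons /= => size_zs.
case: zs => [|z zs] in alt' size_zs *.
  exists (spline k.+1 x < 0), x, [::]; split=> //; rewrite num_belowS.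
  by move: size_zs size_ys => /=; lia.
exists b', z, zs; split=> //; rewrite num_belowS.
by move: size_zs size_ys => /=; lia.
Qed.

Section TopDegree.

Variable d : nat.
Hypothesis le_ed : forall i, c i != 0 -> (e i <= d)%N.

Lemma spline_gt_degree x : spline d.+1 x = 0.
Proof.
rewrite /spline pieceE big1 ?horner0 // => i _.
have [->|/le_ed le_i] := eqVneq (c i) 0; first by rewrite scale0r.
by rewrite derivn_XsubC_exp ffact_small // mulr0n scaler0.
Qed.

Hypothesis inj_a : {in [pred i | (c i != 0) && (e i == d)] &, injective a}.

(** At the leftmost knot of exponent [d] exactly one term has started whose
    [d]-th derivative is not zero. *)
Lemma spline_degree_neq0 : (0 < num_equal d)%N -> exists x, spline d x != 0.
Proof.
case/card_gt0P=> i1 top_i1.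
have [i0 /andP[ci0 /eqP ei0] min_i0] := arg_minP a top_i1.
exists (a i0); rewrite /spline pieceE horner_sum (bigD1 i0) //= big1 => [|i].
  rewrite addr0 hornerZ derivn_XsubC_exp ei0 subnn expr0 hornerMn hornerC.
  by rewrite mulf_neq0 // pnatr_eq0 ffactnn -lt0n fact_gt0.
case/andP=> le_i neq_i; rewrite hornerZ.
have [->|ci] := eqVneq (c i) 0; first by rewrite mul0r.
have [ei|neq_ei] := eqVneq (e i) d.
  case/eqP: neq_i; apply: inj_a; rewrite ?inE ?ci ?ci0 ?ei ?ei0 ?eqxx //.
  by apply/eqP; rewrite eq_le le_i min_i0 //= ci ei eqxx.
have lt_ei : (e i < d)%N by rewrite ltn_neqAle neq_ei le_ed.
by rewrite derivn_XsubC_exp ffact_small // mulr0n horner0 mulr0.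
Qed.

(** The distinctness of the knots of exponent [d] keeps the [d]-th derivative,
    and so all lower ones, from vanishing identically. That derivative is a
    step function with at most [num_equal d] steps, which bounds from above the
    count that [spline_alternates] bounds from below. *)
Lemma relation_degree_bound : (0 < num_equal d)%N ->
  \sum_i c i *: ('X - (a i)%:P) ^+ e i = 0 ->
  (1 < num_equal d)%N /\
  (d + num_equal d + 2 <= 2 * num_terms)%N.
Proof.
move=> top rel.
have f_neq0 j : (j <= d)%N -> exists x, spline j x != 0.
  move/subKn <-; elim: (d - j)%N => [|m [x fx]].
    by rewrite subn0; apply: spline_degree_neq0.
  have [lt_md|le_dm] := ltnP m d.
    by apply: (@spline_neq0_antideriv _ x); rewrite -subSn.
  by exists x; move: fx; rewrite (_ : d - m.+1 = d - m)%N //; lia.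
pose lo := \big[Num.min/0]_i a i - 1.
have lo_lt i : lo < a i.
  by rewrite ltrBlDr (le_lt_trans (bigmin_le _ i _)) // ltrDl ltr01.
have [b [x [xs [alt size_xs]]]] := spline_alternates rel lo_lt f_neq0.
have [z0 f_right] := spline_eq0_right rel.
have f_lo := spline_eq0_left d lo_lt (lexx lo).
have [hi inc] := alternates_increments f_lo (ex_intro _ z0 (f_right d)) alt.
have := rolle_step_spline spline_gt_degree inc.
rewrite num_jumps_left // size_rcons /= => size_le.
have := num_belowS d.
have -> : num_below d.+1 = num_terms.
  apply: eq_card => i; rewrite !inE ltnS.
  by case: (boolP (c i == 0)) => //= /le_ed.
move=> ->; move: (size xs) size_xs size_le => m; lia.
Qed.

End TopDegree.

End Spline.

Theorem proposition3p1 (R : realType) (s : nat) (hs : (1 <= s)%N)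
    (a : 'I_s -> R) (e : 'I_s -> nat)
    (he : forall i : 'I_s, (maxn 1 (2 * s - 4) <= e i)%N)
    (hdist : injective (fun i : 'I_s => (a i, e i))) :
  lin_indep (fun i : 'I_s => ('X - (a i)%:P) ^+ e i : {poly R}).
Proof.
move=> c rel i1; apply/eqP/negPn/negP => ci1.
(* The relation runs over the indices with nonzero coefficient, and [e i0] is
   the largest exponent among them. *)
have [i0 ci0 max_i0] := arg_maxnP e (ci1 : [pred i | c i != 0] i1).
have inj_a : {in [pred i | (c i != 0) && (e i == e i0)] &, injective a}.
  move=> i j /andP[_ /eqP ei] /andP[_ /eqP ej] eq_a.
  by apply: hdist; rewrite eq_a ei ej.
have top : (0 < num_equal e c (e i0))%N.
  by apply/card_gt0P; exists i0; rewrite !inE eqxx andbT.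
have [top2 bound] := relation_degree_bound max_i0 inj_a top rel.
have le_supp : (num_terms c <= s)%N.
  by rewrite -[leqRHS]card_ord max_card.
have all_top : num_equal e c (e i0) = num_terms c.
  apply: eq_card => i; rewrite !inE; case: (boolP (c i == 0)) => //= /max_i0 le_i.
  by have := he i; have := he i0; move: top2 bound le_supp le_i => /=; lia.
by have := he i0; move: top2 bound; rewrite all_top; lia.
Qed.
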